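(* Let $n \in \mathbb{N}$ and let $\{A_i\}_{i \in \mathcal{I}}$ be a finite collection of non-singular real diagonal $n \times n$ matrices. Then the pressure $P : [0,\infty) \to \mathbb{R}$ of $\{A_i\}_{i \in \mathcal{I}}$ is piecewise real analytic.
   Context: The index set $\mathcal{I}$ is finite and non-empty, and $\mathcal{I}^* = \bigcup_{k \geq 1} \mathcal{I}^k$ is the set of all finite words over $\mathcal{I}$. For $\mathbf{i} = (i_1,\dots,i_k) \in \mathcal{I}^*$ write $A_{\mathbf{i}} = A_{i_1} A_{i_2} \cdots A_{i_k}$, and let $\alpha_1(\mathbf{i}) \geq \dots \geq \alpha_n(\mathbf{i}) > 0$ be the singular values of $A_{\mathbf{i}}$ (the positive square roots of the eigenvalues of $A_{\mathbf{i}}^T A_{\mathbf{i}}$, with multiplicity). For $s \in [0,n)$, the singular value function is $$\phi^s(\mathbf{i}) = \alpha_1(\mathbf{i}) \cdots \alpha_m(\mathbf{i})\, \alpha_{m+1}(\mathbf{i})^{s-m},$$ where $m \in \{0,\dots,n-1\}$ is the unique integer with $m \leq s < m+1$. The pressure $P:[0,\infty) \to \mathbb{R}$ of $\{A_i\}_{i\in\mathcal{I}}$ is $$P(s) = \lim_{k \to \infty} \frac{1}{k} \log \sum_{\mathbf{i} \in \mathcal{I}^k} \phi^s(\mathbf{i}) \quad (0 \leq s < n), \qquad P(s) = \log \sum_{i \in \mathcal{I}} |\det A_i|^{s/n} \quad (s \geq n).$$ The limit exists because $\phi^s$ is submultiplicative: $\phi^s(\mathbf{i}\,\mathbf{j})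 \leq \phi^s(\mathbf{i})\phi^s(\mathbf{j})$. A real valued function on a domain $D \subseteq \mathbb{R}$ is piecewise real analytic if $D$ can be written as the closure of the union of a finite collection of open (possibly unbounded) intervals such that the function is real analytic on each of these intervals. *)

(* Defs.v *)
(* MathComp + MathComp-Analysis; the reals are an arbitrary [R : realType]. *)
From mathcomp Require Import all_boot all_order all_algebra.
From mathcomp Require Import all_classical all_reals all_analysis.

Set Implicit Arguments.
Unset Strict Implicit.
Unset Printing Implicit Defensive.

Import Order.TTheory GRing.Theory Num.Theory.
Import numFieldNormedType.Exports.


Local Open Scope classical_set_scope.
Local Open Scope ring_scope.

Section Pressure.
Variable R : realType.

(* The eigenvalues of M^T M with multiplicity are the roots of its
   characteristic polynomial, so s lists their nonnegative square roots in
   nonincreasing order.  By unique factorization at most one s qualifies, and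
   by the spectral theorem one exists, so the default value [::] of [xget] is
   never used. *)
Definition is_singular_values (n : nat) (M : 'M[R]_n) (s : seq R) : Prop :=
  [/\ sorted >=%R s, {in s, forall a, 0 <= a} &
      char_poly (M^T *m M) = \prod_(a <- s) ('X - (a ^+ 2)%:P)].

Definition singular_values (n : nat) (M : 'M[R]_n) : seq R :=
  xget [::] [set s | is_singular_values M s].

(* Indices start at 0: alpha_{j+1} is [(singular_values M)`_j].
   Meaningful for 0 <= t < n. *)
Definition singular_value_function (n : nat) (t : R) (M : 'M[R]_n) : R :=
  let m := Num.truncn t in
  (\prod_(j < m) (singular_values M)`_j) *
  (singular_values M)`_m `^ (t - m%:R).

Definition word_mx (n : nat) (I : finType) (A : I -> 'M[R]_n) (w : seq I) :
  'M[R]_n := \prod_(i <- w) A i.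

Definition pressure (n : nat) (I : finType) (A : I -> 'M[R]_n) (t : R) : R :=
  if t < n%:R then
    lim ((k%:R^-1 * ln (\sum_(w : k.-tuple I)
           singular_value_function t (word_mx A w))) @[k --> \oo])
  else ln (\sum_(i : I) `|\det (A i)| `^ (t / n%:R)).

Definition real_analytic_on (U : set R) (f : R -> R) : Prop :=
  forall a, U a -> exists (c : R^nat) (r : R), 0 < r /\
    forall x, U x -> `|x - a| < r -> pseries c (x - a) @ \oo --> f x.

(* Since D is the closure of the union, the intervals lie in D and the values
   of f outside D are irrelevant. *)
Definition piecewise_real_analytic (D : set R) (f : R -> R) : Prop :=
  exists s : seq (interval R),
    [/\ {in s, forall J, open [set` J]},
        D = closure (\bigcup_(J in [set` s]) [set` J]) &
        {in s, forall J, real_analytic_on [set` J] f}].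

End Pressure.

(* Main.v *)
Require Import Defs.
From mathcomp Require Import all_boot all_order all_algebra.
From mathcomp Require Import all_classical all_reals all_analysis.
From mathcomp Require Import perm ring lra.
Import Order.TTheory GRing.Theory Num.Theory.
Import numFieldNormedType.Exports.
Local Open Scope classical_set_scope.
Local Open Scope ring_scope.

Set Implicit Arguments.
Unset Strict Implicit.
Unset Printing Implicit Defensive.

(** For diagonal matrices the pressure is a maximum of finitely many
explicit functions.  Write [x_i j] for the logarithm of the modulus of the
[j]-th diagonal entry of [A i].  The singular values of a word are the moduli
of its diagonal entries in decreasing order, and by a rearrangement inequality
the singular value function at [t], with [m <= t < m + 1], is the largest over
all permutations [s] of the product of the moduli in positions
[s 0, ..., s (m - 1)] and of the power [t - m] of the modulus in position
[s m] ([singular_value_function_diag]).  For a fixed [s] this product is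
multiplicative along words, so its sum over the words of length [k] is exactly
the [k]-th power of
[[
    g_s(t) = \sum_i expR (\sum_(j < m) x_i (s j) + (t - m) * x_i (s m)).
]]
Replacing the maximum over the [n!] permutations by a sum costs a factor at
most [n!], which vanishes under [k^-1 * ln] as [k] grows; hence the pressure at
[t] is the logarithm of the largest [g_s(t)] ([pressure_dominant]).  For
[n <= t] the pressure is by definition the logarithm of such a sum.

Two facts about sums of exponentials finish the proof.

- The difference of two of them is a real combination of finitely many
exponentials, which either is identically zero or has finitely many zeros, by
Rolle's theorem and induction on the number of exponentials
([exp_comb_many_zeros]).  Away from these zeros and from the integers
[0, ..., n], the intermediate value theorem shows that one and the same [s]
realizes the maximum on a whole interval ([exp_comb_dominant]).

- The logarithm of a positive sum of exponentials is real analytic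
([log_sum_exp_analytic]).  Its derivative is a polynomial in the normalized
weights [expR (u i + v i * t) / \sum_j expR (u j + v j * t)], which lie in
[[0, 1]], and differentiation acts on such polynomials raising the degree by
one and multiplying the sum of the absolute values of the coefficients by at
most a constant times the degree.  So the derivative of order
[k + 1] is at most [M * B ^+ k * k`!] and the Taylor series converges to the function.

The breakpoints cut the half-line into finitely many open intervals whose
union is dense in it ([mesh]). *)

(** * Derivatives and Taylor series *)

Section Calculus.
Context {R : realType}.
Implicit Types (f g : R -> R) (x y : R).

Lemma is_derive_mul f g x df dg : is_derive x 1 f df -> is_derive x 1 g dg ->
  is_derive x 1 (fun y => f y * g y) (f x * dg + g x * df).
Proof. by move=> ? ?; exact: is_deriveM. Qed.

Lemma is_derive_add f g x df dg : is_derive x 1 f df -> is_derive x 1 g dg ->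
  is_derive x 1 (fun y => f y + g y) (df + dg).
Proof. by move=> ? ?; exact: is_deriveD. Qed.

Lemma is_derive_const (c : R) x : is_derive x 1 (fun=> c) 0.
Proof. exact: is_derive_cst. Qed.

Lemma is_derive_pow k f x df : is_derive x 1 f df ->
  is_derive x 1 (fun y => f y ^+ k) (k%:R * f x ^+ k.-1 * df).
Proof.
move=> fd; elim: k => [|k IHk].
  by rewrite !mul0r; under eq_fun do rewrite expr0; exact: is_derive_const.
under eq_fun do rewrite exprS.
apply: (is_derive_eq (is_derive_mul fd IHk)).
clear IHk; case: k => [|k]/=; first by ring.
by rewrite exprS -natr1; ring.
Qed.

Lemma is_derive_sum_seq (T : Type) (s : seq T) (F : T -> R -> R) (dF : T -> R) x :
  (forall i, is_derive x 1 (F i) (dF i)) ->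
  is_derive x 1 (fun y => \sum_(i <- s) F i y) (\sum_(i <- s) dF i).
Proof.
move=> dFP; elim: s => [|i s IHs].
  by rewrite big_nil; under eq_fun do rewrite big_nil; exact: is_derive_const.
by rewrite big_cons; under eq_fun do rewrite big_cons; exact: is_derive_add.
Qed.

Lemma derive_continuous f : (forall x, derivable f x 1) ->
  forall a b, {within `[a, b], continuous f}.
Proof.
move=> fd a b; apply: continuous_subspaceT => x.
by apply: differentiable_continuous; exact/derivable1_diffP.
Qed.

(** The points [a] and [x] come in any order, because a Taylor expansion is
needed on both sides of its centre [a]. *)
Lemma mean_value (f df : R -> R) (a x : R) : (forall y, is_derive y 1 f (df y)) ->
  exists2 y, `|x - y| <= `|x - a| & f x - f a = df y * (x - a).
Proof.
move=> fd; have fc := @derive_continuous f (fun y => @ex_derive _ _ _ _ _ _ _ (fd y)).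
have [ax|/ltW xa] := leP a x.
  have [y + ->] := MVT_segment ax (fun y _ => fd y) (fc a x).
  rewrite in_itv/= => /andP[ay yx]; exists y => //.
  by rewrite !ger0_norm ?subr_ge0// lerD2l lerN2.
have [y + e] := MVT_segment xa (fun y _ => fd y) (fc x a).
rewrite in_itv/= => /andP[xy ya]; exists y.
  by rewrite !ler0_norm ?subr_le0// lerN2 lerD2l lerN2.
by rewrite -[LHS]opprB e -mulrN opprB.
Qed.

(** Cauchy's form of the remainder.  As a function of the centre [y], the Taylor
polynomial of order [n] evaluated at [x] has a telescoping derivative, of which
only the last term survives; the mean value theorem applies to it between [a]
and [x]. *)
Lemma taylor_remainder (F : nat -> R -> R)
    (dF : forall k y, is_derive y 1 (F k) (F k.+1 y)) n a x :
  exists2 y, `|x - y| <= `|x - a| &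
    F 0%N x - \sum_(k < n.+1) F k a / k`!%:R * (x - a) ^+ k
      = F n.+1 y / n`!%:R * (x - y) ^+ n * (x - a).
Proof.
pose phi m y := \sum_(k < m.+1) F k y / k`!%:R * (x - y) ^+ k.
have dphi m y : is_derive y 1 (phi m) (F m.+1 y / m`!%:R * (x - y) ^+ m).
  have dx : is_derive y 1 (fun z => x - z) (0 + - 1).
    exact: is_derive_add (is_derive_const _ _) (is_deriveNid _ _).
  have dX k : is_derive y 1 (fun z => (x - z) ^+ k) (- (k%:R * (x - y) ^+ k.-1)).
    by have := is_derive_pow k dx; rewrite add0r mulrN1.
  elim: m => [|m IHm].
    rewrite /phi; under eq_fun do rewrite big_ord1 expr0 mulr1 fact0 divr1.
    by rewrite expr0 mulr1 fact0 divr1.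
  rewrite /phi; under eq_fun do rewrite big_ord_recr/=.
  have dFc := is_derive_mul (dF m.+1 y) (is_derive_const (m.+1`!%:R)^-1 y).
  apply: (is_derive_eq (is_derive_add IHm (is_derive_mul dFc (dX m.+1)))).
  rewrite mulr0 add0r/= factS natrM.
  have f0 : m`!%:R != 0 :> R by rewrite pnatr_eq0 -lt0n fact_gt0.
  have f1 : (1 + m%:R) != 0 :> R by rewrite nat1r pnatr_eq0.
  by field; apply/andP.
have [y yx e] := mean_value a x (dphi n).
exists y => //; rewrite -e; congr (_ - _).
rewrite /phi big_ord_recl/= fact0 divr1 expr0 mulr1 big1 ?addr0// => i _.
by rewrite subrr expr0n/= mulr0.
Qed.

(** Cauchy's remainder is at most [M * `|x - a| * (B * `|x - a|) ^+ n], which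
tends to [0] as soon as [`|x - a| < B^-1]. *)
Lemma real_analytic_of_derivative_bound (F : nat -> R -> R) (M B : R) U :
  0 < B -> (forall k y, is_derive y 1 (F k) (F k.+1 y)) ->
  (forall k y, `|F k.+1 y| <= M * B ^+ k * k`!%:R) ->
  real_analytic_on U (F 0%N).
Proof.
move=> B0 dF bF a Ua; exists (fun k => F k a / k`!%:R), B^-1.
rewrite invr_gt0; split => // x _ xa.
rewrite -(@cvg_shiftS _) /pseries.
have q1 : `|B * `|x - a| | < 1.
  by rewrite ger0_norm ?mulr_ge0// ?ltW// mulrC -ltr_pdivlMr// div1r.
have /cvgr0Pnorm_lt z := cvg_geometric (M * `|x - a|) q1.
apply/cvgrPdist_lt => e e0; near=> n.
rewrite /= /series/= big_mkord.
have [y yx ->] := taylor_remainder dF n a x.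
apply: (@le_lt_trans _ _ (M * `|x - a| * (B * `|x - a|) ^+ n)).
  rewrite !normrM normrX normfV normr_nat.
  have f0 : 0 < n`!%:R :> R by rewrite ltr0n fact_gt0.
  apply: (@le_trans _ _ (M * B ^+ n * `|x - a| ^+ n * `|x - a|)).
    apply: ler_wpM2r => //; apply: ler_pM => //.
    - by rewrite ler_pdivrMr.
    - by rewrite lerXn2r ?nnegrE.
  by rewrite exprMn -!mulrA (mulrC _ `|x - a|) (mulrCA (B ^+ n)).
apply: le_lt_trans (ler_norm _) _.
by near: n; exact: z.
Unshelve. all: by end_near. Qed.
End Calculus.

(** * Analyticity of the logarithm of a sum of exponentials *)

Section LogSumExp.
Context {R : realType} {I : finType}.
Variables u v : I -> R.
Implicit Types (t : R) (i j : I) (s : seq I) (l : seq (R * seq I)).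

Definition sum_exp (t : R) : R := \sum_i expR (u i + v i * t).

(** The Gibbs weights: for each [t] a probability vector indexed by [I]. *)
Definition gibbs (i : I) (t : R) : R := expR (u i + v i * t) / sum_exp t.

Definition gibbs_monomial (s : seq I) (t : R) : R := \prod_(i <- s) gibbs i t.

(** The entries of [l] are pairs of a coefficient and a monomial, so that both
the degree and the size of the coefficients can be read off and controlled
under differentiation. *)
Definition gibbs_poly (l : seq (R * seq I)) (t : R) : R :=
  \sum_(k <- l) k.1 * gibbs_monomial k.2 t.

(** Leibniz's rule on the monomials: the derivative of [gibbs i] is
[gibbs i * (v i - \sum_j v j * gibbs j)], so each factor contributes its slope
to the first term and a copy of the mean slope to the others. *)
Definition gibbs_poly_deriv (l : seq (R * seq I)) : seq (R * seq I) :=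
  flatten [seq (k.1 * \sum_(i <- k.2) v i, k.2) ::
    [seq (- k.1 * (size k.2)%:R * v j, j :: k.2) | j <- index_enum I] | k <- l].

Definition gibbs_coef_norm (l : seq (R * seq I)) : R := \sum_(k <- l) `|k.1|.

Lemma is_derive_exp_affine i t :
  is_derive t 1 (fun y => expR (u i + v i * y)) (v i * expR (u i + v i * t)).
Proof.
have d : is_derive t 1 (fun y => u i + v i * y) (0 + (v i * 1 + t * 0)).
  have dv := is_derive_mul (is_derive_const (v i) t) (is_derive_id t 1).
  exact: is_derive_add (is_derive_const (u i) t) dv.
have := is_derive1_comp (is_derive_expR _) d.
by rewrite add0r mulr1 mulr0 addr0 mulrC.
Qed.

Lemma is_derive_sum_exp t :
  is_derive t 1 sum_exp (\sum_i v i * expR (u i + v i * t)).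
Proof.
exact: is_derive_sum_seq _ (fun i => is_derive_exp_affine i t).
Qed.

Hypothesis I0 : (0 < #|I|)%N.

Lemma sum_exp_gt0 t : 0 < sum_exp t.
Proof.
have [i _] := card_gt0P I0.
by rewrite /sum_exp (bigD1 i)//= ltr_pwDl ?expR_gt0// sumr_ge0.
Qed.

Lemma gibbs_itv i t : 0 <= gibbs i t <= 1.
Proof.
rewrite divr_ge0 ?expR_ge0 ?(ltW (sum_exp_gt0 t))//=.
rewrite ler_pdivrMr ?sum_exp_gt0// mul1r /sum_exp (bigD1 i)//= lerDl.
by apply: sumr_ge0 => j _; exact: expR_ge0.
Qed.

Lemma gibbs_monomial_le1 s t : `|gibbs_monomial s t| <= 1.
Proof.
rewrite normr_prod; apply: prodr_ile1 => i _.
by have /andP[g0 g1] := gibbs_itv i t; rewrite ger0_norm// g0.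
Qed.

Lemma is_derive_gibbs i t :
  is_derive t 1 (gibbs i) (gibbs i t * (v i - \sum_j v j * gibbs j t)).
Proof.
have Z0 : sum_exp t != 0 by rewrite gt_eqF ?sum_exp_gt0.
have dV := is_deriveV Z0 (is_derive_sum_exp t).
apply: (is_derive_eq (is_derive_mul (is_derive_exp_affine i t) dV)).
rewrite -[_ *: _]/(_ * _) /gibbs /=.
under [in RHS]eq_bigr do rewrite mulrA.
rewrite -mulr_suml; field.
exact: Z0.
Qed.

Lemma is_derive_gibbs_monomial s t : is_derive t 1 (gibbs_monomial s)
  (gibbs_monomial s t * (\sum_(i <- s) v i - (size s)%:R * \sum_j v j * gibbs j t)).
Proof.
elim: s => [|i s IHs].
  rewrite /gibbs_monomial; under eq_fun do rewrite big_nil.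
  by rewrite !big_nil/= mul0r subr0 mulr0; exact: is_derive_const.
rewrite [X in is_derive _ _ X](_ : _ = fun y => gibbs i y * gibbs_monomial s y).
  apply: (is_derive_eq (is_derive_mul (is_derive_gibbs i t) IHs)).
  by rewrite /gibbs_monomial !big_cons -/(gibbs_monomial s t) /= -natr1; ring.
by apply/funext => y; rewrite /gibbs_monomial big_cons.
Qed.

Lemma is_derive_gibbs_poly l t :
  is_derive t 1 (gibbs_poly l) (gibbs_poly (gibbs_poly_deriv l) t).
Proof.
rewrite /gibbs_poly /gibbs_poly_deriv big_flatten big_map.
apply: is_derive_sum_seq => k.
apply: (is_derive_eq (is_derive_mul (is_derive_const k.1 t) (is_derive_gibbs_monomial k.2 t))).
rewrite big_cons big_map /=.
have -> : \sum_j - k.1 * (size k.2)%:R * v j * gibbs_monomial (j :: k.2) t =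
    - k.1 * (size k.2)%:R * gibbs_monomial k.2 t * \sum_j v j * gibbs j t.
  by rewrite mulr_sumr; apply: eq_bigr => j _; rewrite /gibbs_monomial big_cons; ring.
by ring.
Qed.

(** The weights lie in [[0, 1]], hence so do the moduli of the monomials. *)
Lemma gibbs_poly_le_norm l t : `|gibbs_poly l t| <= gibbs_coef_norm l.
Proof.
apply: le_trans (ler_norm_sum _ _ _) _; apply: ler_sum => k _.
by rewrite normrM ler_piMr// gibbs_monomial_le1.
Qed.

Definition slope_bound : R := \sum_j `|v j|.

(** This linear growth in the degree is what produces the factorial, and no
more, in the bound on the successive derivatives. *)
Lemma gibbs_poly_deriv_norm d l : all (fun k => size k.2 <= d)%N l ->
  gibbs_coef_norm (gibbs_poly_deriv l)
    <= d%:R * (2 * slope_bound) * gibbs_coef_norm l.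
Proof.
move=> /allP ld; rewrite /gibbs_coef_norm big_flatten big_map mulr_sumr.
rewrite big_seq [leRHS]big_seq; apply: ler_sum => k /ld kd.
rewrite big_cons big_map/= normrM.
have -> : \sum_j `|- k.1 * (size k.2)%:R * v j|
    = `|k.1| * (size k.2)%:R * slope_bound.
  rewrite mulr_sumr; apply: eq_bigr => j _.
  by rewrite !normrM normrN normr_nat.
have L0 : 0 <= slope_bound by exact: sumr_ge0.
have b1 : `|\sum_(i <- k.2) v i| <= (size k.2)%:R * slope_bound.
  apply: le_trans (ler_norm_sum _ _ _) _.
  elim: (k.2) => [|i s IHs]; first by rewrite big_nil mul0r.
  rewrite big_cons /= -nat1r mulrDl mul1r lerD//.
  by rewrite /slope_bound (bigD1 i)//= lerDl sumr_ge0.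
have b2 : (size k.2)%:R * slope_bound <= d%:R * slope_bound.
  by rewrite ler_wpM2r// ler_nat.
have : `|k.1| * (`|\sum_(i <- k.2) v i| + (size k.2)%:R * slope_bound)
       <= `|k.1| * (d%:R * slope_bound + d%:R * slope_bound).
  by rewrite ler_wpM2l// lerD// (le_trans b1).
lra.
Qed.

Lemma gibbs_poly_deriv_degree d l : all (fun k => size k.2 <= d)%N l ->
  all (fun k => size k.2 <= d.+1)%N (gibbs_poly_deriv l).
Proof.
move=> /allP ld; apply/allP => k /flatten_mapP[k' /ld k'd].
rewrite inE => /orP[/eqP->|/mapP[j _ ->]]//=; exact: leqW.
Qed.

(** The first derivative is [gibbs_poly l0], of degree one; its [k]-th derivative
has degree [k + 1], so iterating [gibbs_poly_deriv_norm] multiplies the factors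
[1, ..., k] into [k`!]. *)
Theorem log_sum_exp_analytic U : real_analytic_on U (fun t => ln (sum_exp t)).
Proof.
pose l0 := [seq (v j, [:: j]) | j <- index_enum I].
pose l k := iter k gibbs_poly_deriv l0.
pose F k t := if k is k'.+1 then gibbs_poly (l k') t else ln (sum_exp t).
have ldeg k : all (fun p => size p.2 <= k.+1)%N (l k).
  elim: k => [|k IHk]; last exact: gibbs_poly_deriv_degree.
  by apply/allP => p /mapP[j _ ->].
have L0 : 0 <= slope_bound by exact: sumr_ge0.
have C0 : 0 <= gibbs_coef_norm l0 by exact: sumr_ge0.
(* The summand 1 only ensures 0 < B, in case all the slopes vanish. *)
pose B := 2 * slope_bound + 1.
have lnorm k : gibbs_coef_norm (l k) <= gibbs_coef_norm l0 * B ^+ k * k`!%:R.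
  elim: k => [|k IHk]; first by rewrite expr0 !mulr1.
  apply: le_trans (gibbs_poly_deriv_norm (ldeg k)) _.
  rewrite factS natrM exprS.
  rewrite [leRHS](_ : _ = k.+1%:R * B * (gibbs_coef_norm l0 * B ^+ k * k`!%:R)); last ring.
  apply: ler_pM => //; first by rewrite mulr_ge0// mulr_ge0.
    exact: sumr_ge0.
  by rewrite ler_wpM2l// lerDl.
apply: (@real_analytic_of_derivative_bound _ F (gibbs_coef_norm l0) B).
- by rewrite ltr_wpDl// mulr_ge0.
- case=> [|k] t; last exact: is_derive_gibbs_poly.
  have := is_derive1_comp (is_derive1_ln (sum_exp_gt0 t)) (is_derive_sum_exp t).
  rewrite (_ : _^-1 * _ = F 1%N t)//.
  rewrite /F /gibbs_poly big_map mulr_sumr; apply: eq_bigr => j _.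
  by rewrite /gibbs_monomial big_seq1 /gibbs mulrC mulrA.
- by move=> k t; exact: le_trans (gibbs_poly_le_norm _ _) (lnorm k).
Qed.

End LogSumExp.

(** * Zeros of exponential sums and the partition of the half-line *)

Section ExponentialSums.
Context {R : realType}.
Implicit Types (f : R -> R) (t x y : R) (l : seq (R * R)) (s : seq R).

(** The conclusion puts the new zeros in a path that starts at [x]; this is the
form that makes the induction go through. *)
Lemma rolle_path f (df : R -> R) x s : (forall y, is_derive y 1 f (df y)) ->
  path <%R x s -> f x = 0 -> {in s, forall y, f y = 0} ->
  exists s', [/\ path <%R x s', size s' = size s & {in s', forall y, df y = 0}].
Proof.
move=> fd; elim: s x => [|y s IHs] x /=; first by exists [::].
move=> /andP[xy ys] fx0 fs0.
have fy0 : f y = 0 by apply: fs0; rewrite mem_head.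
have [|s' [ys' ss' ds']] := IHs _ ys fy0.
  by move=> z zs; apply: fs0; rewrite inE zs orbT.
have fD z : derivable f z 1 := @ex_derive _ _ _ _ _ _ _ (fd z).
have [|c cxy dc] := Rolle xy (fun z _ => fD z) (@derive_continuous _ f fD x y).
  by rewrite fx0 fy0.
move: cxy; rewrite in_itv/= => /andP[xc cy].
exists (c :: s'); split => /=.
- rewrite xc/=; case: s' ys' {ss' ds'} => //= z s' /andP[yz ->].
  by rewrite (lt_trans cy).
- by rewrite ss'.
- move=> z; rewrite inE => /predU1P[->|]; last exact: ds'.
  by rewrite -(@derive_val _ _ _ _ _ _ _ (fd c)) (@derive_val _ _ _ _ _ _ _ dc).
Qed.

Definition exp_comb l t : R := \sum_(k <- l) k.1 * expR (k.2 * t).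

Lemma is_derive_exp_comb l t :
  is_derive t 1 (exp_comb l) (exp_comb [seq (k.1 * k.2, k.2) | k <- l] t).
Proof.
rewrite /exp_comb big_map; apply: is_derive_sum_seq => k /=.
have dk : is_derive t 1 (fun y => k.2 * y) (k.2 * 1 + t * 0).
  exact: is_derive_mul (is_derive_const _ _) (is_derive_id _ _).
have dE := is_derive1_comp (is_derive_expR (k.2 * t)) dk.
apply: (is_derive_eq (is_derive_mul (is_derive_const k.1 t) dE)).
by rewrite /=; ring.
Qed.

(** Dividing by the first exponential turns it into a constant, which
differentiation kills; Rolle's theorem leaves one zero less for one exponential
less.  If the derivative vanishes identically, the quotient is a constant that
vanishes at [x]. *)
Lemma exp_comb_many_zeros l s : sorted <%R s -> (size l <= size s)%N ->
  {in s, forall x, exp_comb l x = 0} -> forall t, exp_comb l t = 0.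
Proof.
elim: {l}(size l) {-2}l (erefl (size l)) s => [l /size0nil -> s _ _ _ t|n IHn].
  by rewrite /exp_comb big_nil.
case=> // -[c a] l /= [ln] [|x s]//= xs; rewrite ln ltnS => ns l0.
pose sh := [seq (k.1, k.2 - a) | k <- (c, a) :: l].
have shE t : exp_comb ((c, a) :: l) t = expR (a * t) * exp_comb sh t.
  rewrite /exp_comb big_map mulr_sumr; apply: eq_bigr => k _.
  by rewrite mulrCA -expRD -mulrDl [a + _]addrC subrK.
have sh0 y : exp_comb ((c, a) :: l) y = 0 -> exp_comb sh y = 0.
  by rewrite shE => /eqP; rewrite mulf_eq0 gt_eqF ?expR_gt0// => /eqP.
pose dsh := [seq (k.1 * k.2, k.2) | k <- behead sh].
have shd y : is_derive y 1 (exp_comb sh) (exp_comb dsh y).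
  apply: (is_derive_eq (is_derive_exp_comb sh y)).
  by rewrite /exp_comb /dsh/= big_cons/= subrr mulr0 mul0r add0r.
have [||s' [xs' ss' ds']] := rolle_path shd xs.
- by apply/sh0/l0; rewrite mem_head.
- by move=> y ys; apply/sh0/l0; rewrite inE ys orbT.
have dsh0 : forall t, exp_comb dsh t = 0.
  apply: (IHn _ _ s') => //; first by rewrite !size_map.
  - exact: path_sorted xs'.
  - by rewrite !size_map ss' ln.
have shd0 y : is_derive y 1 (exp_comb sh) 0 by rewrite -(dsh0 y).
move=> t; rewrite shE (is_derive_0_is_cst t x shd0).
by rewrite sh0 ?mulr0// l0// mem_head.
Qed.

Lemma exp_comb_zeros l : (forall t, exp_comb l t = 0) \/
  exists s : seq R, forall t, exp_comb l t = 0 -> t \in s.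
Proof.
have [/finite_seqP[s sE]|/(infinite_set_fset (size l))[B Bl lB]] :=
    pselect (finite_set [set t | exp_comb l t = 0]).
  right; exists s => t t0.
  by have : [set t | exp_comb l t = 0] t by []; rewrite sE.
left; pose s : seq R := sort <=%R (finmap.enum_fset B).
apply: (@exp_comb_many_zeros l s).
- by rewrite sort_lt_sorted finmap.fset_uniq.
- by rewrite size_sort.
- by move=> x; rewrite mem_sort => /Bl.
Qed.

Lemma exp_comb_continuous l a b : {within `[a, b], continuous (exp_comb l)}.
Proof.
have cd t : derivable (exp_comb l) t 1 := @ex_derive _ _ _ _ _ _ _ (is_derive_exp_comb l t).
exact: (@derive_continuous _ _ cd).
Qed.

Lemma exp_comb_sign l (J : interval R) x y :
  (forall t, t \in J -> exp_comb l t != 0) ->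
  x \in J -> y \in J -> 0 <= exp_comb l x -> 0 <= exp_comb l y.
Proof.
move=> l0 xJ yJ fx; rewrite leNgt; apply/negP => fy.
have Jconv a b z : a \in J -> b \in J -> z \in `[a, b] -> z \in J.
  by move=> aJ bJ; rewrite in_itv; exact: (@interval_is_interval _ J).
have [xy|/ltW yx] := leP x y.
  have [|c + /eqP] := @IVT _ (exp_comb l) x y 0 xy (@exp_comb_continuous l x y).
    by rewrite ge_min le_max fx (ltW fy) orbT.
  by move=> /(Jconv _ _ _ xJ yJ)/l0/negPf->.
have [|c + /eqP] := @IVT _ (exp_comb l) y x 0 yx (@exp_comb_continuous l y x).
  by rewrite ge_min le_max fx (ltW fy) orbT.
by move=> /(Jconv _ _ _ yJ xJ)/l0/negPf->.
Qed.

(** The set [s] collects the zeros of all the differences that do not vanish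
identically.  On an interval that avoids [s] no difference changes sign, so an
index that is maximal at one point is maximal everywhere. *)
Lemma exp_comb_dominant (T : finType) (i0 : T) (l : T -> seq (R * R)) :
  exists s : seq R, forall J : interval R, {in s, forall z, z \notin J} ->
    exists i, forall t j, t \in J -> exp_comb (l j) t <= exp_comb (l i) t.
Proof.
pose d i j := l i ++ [seq (- k.1, k.2) | k <- l j].
have dE i j t : exp_comb (d i j) t = exp_comb (l i) t - exp_comb (l j) t.
  rewrite /exp_comb big_cat/= big_map -sumrN; congr (_ + _).
  by apply: eq_bigr => k _; rewrite mulNr.
have /choice[z zP] : forall p : T * T, exists s : seq R,
    (forall t, exp_comb (d p.1 p.2) t = 0) \/
    (forall t, exp_comb (d p.1 p.2) t = 0 -> t \in s).
  move=> p; have [p0|[s sP]] := exp_comb_zeros (d p.1 p.2).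
    by exists [::]; left.
  by exists s; right.
exists (flatten [seq z p | p <- index_enum (T * T)%type]) => J sJ.
have [[x xJ]|J0] := pselect (exists x, x \in J); last first.
  by exists i0 => t j tJ; exfalso; apply: J0; exists t.
pose i := [arg max_(i > i0) exp_comb (l i) x]%O.
exists i => t j tJ; rewrite -subr_ge0 -dE.
have [/= ->//|/= zij] := zP (i, j).
apply: (@exp_comb_sign _ J x) => //; last first.
  rewrite dE subr_ge0 /i; case: Order.TotalTheory.arg_maxP => // i1 _; exact.
move=> y yJ; apply/eqP => /zij yz.
suff /sJ : y \in flatten [seq z p | p <- index_enum (T * T)%type] by rewrite yJ.
by apply/flatten_mapP; exists (i, j) => //; rewrite mem_index_enum.
Qed.

Lemma closure_oo x y : x < y -> closure `]x, y[%classic = `[x, y]%classic.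
Proof.
move=> xy; apply/seteqP; split; first exact: itv_closure.
move=> z; rewrite /= in_itv/= => /andP[xz zy] B /nbhs_ballP[e /= e0 eB].
(* ]a, b[ is the trace on ]x, y[ of the ball of radius e / 2 centred at z; its
   midpoint lies in both. *)
pose a := Num.max x (z - e / 2); pose b := Num.min y (z + e / 2).
have e2 : 0 < e / 2 by rewrite divr_gt0.
have ab : a < b.
  rewrite /a /b gt_max !lt_min xy/= (le_lt_trans xz) ?ltrDl//=.
  by rewrite (lt_le_trans _ zy) ?gtrBl// ltrBlDr -addrA ltrDl addr_gt0.
have [ac cb] := midf_lt ab.
exists ((a + b) / 2); split.
  rewrite /= in_itv/=; apply/andP; split.
    by apply: le_lt_trans ac; rewrite /a le_max lexx.
  by apply: lt_le_trans cb _; rewrite /b ge_min lexx.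
apply: eB; rewrite /ball/= ltr_distlC; apply/andP; split.
  apply: le_lt_trans ac; rewrite /a le_max orbC lerD2l lerN2.
  by rewrite ler_pdivrMr// ler_pMr// ler1n.
apply: lt_le_trans cb _; rewrite /b ge_min orbC lerD2l.
by rewrite ler_pdivrMr// ler_pMr// ler1n.
Qed.

Lemma closure_oy x : closure `]x, +oo[%classic = `[x, +oo[%classic.
Proof.
apply/seteqP; split.
  rewrite [X in _ `<=` X](closure_id _).1; last exact: rray_closed.
  by apply: closure_subset => z; rewrite /= !in_itv/= !andbT => /ltW.
move=> z; rewrite /= in_itv/= andbT => xz.
have : closure `]x, z + 1[%classic z.
  have xz1 : x < z + 1 by rewrite (le_lt_trans xz)// ltrDl.
  by rewrite closure_oo//= in_itv/= xz lerDl/=.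
by apply: closure_subset => w; rewrite /= !in_itv/= => /andP[->].
Qed.

(** The intervals are those between consecutive points of [x :: s], and the
unbounded one after the last point. *)
Lemma mesh x s : path <%R x s -> exists L : seq (interval R),
  [/\ {in L, forall J, open [set` J]},
      `[x, +oo[%classic = closure (\bigcup_(J in [set` L]) [set` J]) &
      {in L, forall J, {in J, forall z, x < z} /\ {in x :: s, forall z, z \notin J}}].
Proof.
elim: s x => [x _|y s IHs x /= /andP[xy ys]].
  exists [:: Interval (BRight x) (BInfty _ false)]; split.
  - by move=> J; rewrite inE => /eqP ->; exact: rray_open.
  - by rewrite set_cons1 bigcup_set1 closure_oy.
  - move=> J; rewrite inE => /eqP ->; split=> z; first by rewrite in_itv/= andbT.
    by rewrite inE => /eqP->; rewrite in_itv/= ltxx.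
have [L [Lo Lc LJ]] := IHs _ ys.
exists (Interval (BRight x) (BLeft y) :: L); split.
- by move=> J; rewrite inE => /predU1P[->|/Lo//]; exact: itv_open.
- rewrite bigcup_seq big_cons -bigcup_seq closureU -Lc closure_oo//.
  apply/seteqP; split=> z; rewrite /= !in_itv/= !andbT.
    by move=> xz; case: (leP z y) => [zy|/ltW yz]; [left|right]; rewrite ?xz.
  by case=> [/andP[]//|]; apply: le_trans; exact: ltW.
- move=> J; rewrite inE => /predU1P[->|JL].
    split=> z; first by rewrite in_itv/= => /andP[].
    rewrite in_itv/= inE => /predU1P[->|]; first by rewrite ltxx.
    rewrite inE => /predU1P[->|zs]; first by rewrite ltxx andbF.
    have /allP/(_ _ zs) yz := order_path_min lt_trans ys.
    by rewrite (lt_gtF yz) andbF.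
  have [Jy sJ] := LJ _ JL; split=> z; first by move=> /Jy; exact: lt_trans.
  rewrite inE => /predU1P[->|]; last exact: sJ.
  by apply/negP => /Jy; rewrite ltNge (ltW xy).
Qed.

(** The breakpoints can be given in any order and on any side of [0], so they
can be collected from several sources without care. *)
Lemma piecewise_of_breakpoints f (Z : seq R) :
  (forall J : interval R, {in J, forall t, 0 < t} -> {in Z, forall z, z \notin J} ->
    real_analytic_on [set` J] f) ->
  piecewise_real_analytic `[0, +oo[ f.
Proof.
move=> fZ; pose s := sort <=%R (undup [seq z <- Z | 0 < z]).
have s0 : path <%R 0 s.
  rewrite path_min_sorted ?sort_lt_sorted ?undup_uniq//.
  by apply/allP => z; rewrite mem_sort mem_undup mem_filter => /andP[].
have [L [Lo Lc LJ]] := mesh s0.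
exists L; split => // J /LJ[J0 sJ]; apply: fZ => // z zZ.
have [z0|z0] := leP z 0.
  by apply/negP => /J0; rewrite ltNge z0.
by apply: sJ; rewrite inE mem_sort mem_undup mem_filter z0 zZ orbT.
Qed.

End ExponentialSums.

(** * Singular values of diagonal matrices *)

Section DiagonalSingularValues.
Context {R : realType} {n : nat}.
Implicit Types (d : 'rV[R]_n) (M : 'M[R]_n) (y : 'I_n -> R) (s : {perm 'I_n}).

(** The characteristic polynomial determines the squares of the singular values
up to order, and the square root recovers nonnegative numbers from their
squares. *)
Lemma singular_values_diag d :
  sorted >=%R (singular_values (diag_mx d)) /\
  perm_eq (singular_values (diag_mx d)) [seq `|d 0 j| | j <- enum 'I_n].
Proof.
pose ds := [seq `|d 0 j| | j <- enum 'I_n].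
have cpE : char_poly ((diag_mx d)^T *m diag_mx d) = \prod_(a <- ds) ('X - (a ^+ 2)%:P).
  rewrite tr_diag_mx mulmx_diag char_poly_trig ?diag_mx_is_trig//.
  rewrite big_map big_enum; apply: eq_bigr => j _.
  by rewrite !mxE eqxx mulr1n real_normK ?num_real// expr2.
have : is_singular_values (diag_mx d) (singular_values (diag_mx d)).
  apply: (@xgetPex _ [::] [set s | is_singular_values (diag_mx d) s]).
  exists (sort >=%R ds); split.
  - by apply: sort_sorted => a b; exact: le_total.
  - by move=> a; rewrite mem_sort => /mapP[j _ ->].
  - by rewrite cpE; apply: perm_big; rewrite perm_sym perm_sort.
move=> [ss s0 cp]; split => //; rewrite -/ds.
move: cp; rewrite cpE -!(big_map (fun a => a ^+ 2) xpredT (fun a => 'X - a%:P)).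
have sqrtK (l : seq R) : {in l, forall a, 0 <= a} ->
    [seq Num.sqrt a | a <- [seq a ^+ 2 | a <- l]] = l.
  move=> l0; rewrite -map_comp -[RHS]map_id; apply/eq_in_map => a /l0 a0.
  by rewrite /= sqrtr_sqr ger0_norm.
move=> /prod_XsubC_eq/(perm_map Num.sqrt); rewrite !sqrtK//; first by rewrite perm_sym.
by move=> _ /mapP[j _ ->].
Qed.

(** Weight one on the first [m] positions and [r] on the next one: with
[r = t - m] these are the exponents of the singular values in the singular
value function. *)
Definition flag_weight (m : nat) (r : R) (j : nat) : R :=
  if (j < m)%N then 1 else if j == m then r else 0.

(** The logarithm of the product that [s] contributes, when [y] lists the
logarithms of the moduli of the diagonal entries. *)
Definition flag_sum (m : nat) (r : R) y s : R :=
  \sum_(j < n) flag_weight m r j * y (s j).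

Lemma flag_sum_affine (m : 'I_n) r y s : flag_sum m r y s =
  \sum_(j < n | (j < m)%N) y (s j) + r * y (s m).
Proof.
rewrite /flag_sum (bigID (fun j : 'I_n => (j < m)%N))/=; congr (_ + _).
  by apply: eq_bigr => j jm; rewrite /flag_weight jm mul1r.
rewrite (bigD1 m) ?ltnn//= big1 ?addr0; first by rewrite /flag_weight ltnn eqxx.
move=> j /andP[/negPf jm] /negPf mj.
by rewrite /flag_weight jm -val_eqE/= in mj *; rewrite mj mul0r.
Qed.

(** A rearrangement inequality.  Let [c] be the value at the pivot [m] of the
decreasing arrangement.  As the weights lie in [[0, 1]] and have a sum that does
not depend on the permutation, any arrangement exceeds [c] times that sum by at
most the sum of the positive parts of [y i - c] over all [i], and the decreasing
one attains this bound. *)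
Lemma flag_sum_max (m : 'I_n) r y s (s' : {perm 'I_n}) : 0 <= r <= 1 ->
  (forall i j : 'I_n, (i <= j)%N -> y (s j) <= y (s i)) ->
  flag_sum m r y s' <= flag_sum m r y s.
Proof.
move=> /andP[r0 r1] ys; pose c := y (s m).
have w01 j : 0 <= flag_weight m r j <= 1.
  by rewrite /flag_weight; case: ifP => _; [|case: ifP => _]; rewrite ?ler01 ?lexx ?r0.
have wE (p : {perm 'I_n}) : flag_sum m r y p =
    \sum_(j < n) flag_weight m r j * c + \sum_(j < n) flag_weight m r j * (y (p j) - c).
  by rewrite -big_split/=; apply: eq_bigr => j _; rewrite -mulrDr addrC subrK.
rewrite !wE lerD2l.
pose pp (i : 'I_n) := Num.max (y i - c) 0.
apply: (@le_trans _ _ (\sum_i pp i)).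
  rewrite [leRHS](reindex_inj (@perm_inj _ s')); apply: ler_sum => j _ /=.
  have /andP[w0 w1] := w01 j.
  have pp0 : 0 <= pp (s' j) by rewrite le_max lexx orbT.
  apply: (@le_trans _ _ (flag_weight m r j * pp (s' j))).
    by rewrite ler_wpM2l// le_max lexx.
  by rewrite ler_piMl.
rewrite (reindex_inj (@perm_inj _ s)) le_eqVlt; apply/orP; left; apply/eqP.
apply: eq_bigr => j _ /=; rewrite /pp /flag_weight.
have [jm|mj] := ltnP j m.
  by rewrite mul1r max_l// subr_ge0 ys// ltnW.
have := ys m j mj; rewrite -/c -subr_le0 => yc; rewrite max_r//.
case: eqP => [jm|_]; last by rewrite mul0r.
by rewrite (_ : j = m) ?subrr ?mulr0//; exact: val_inj.
Qed.

(** Here [s] is a permutation that sorts the moduli in decreasing order. *)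
Lemma singular_value_function_diag d (m : 'I_n) t : (forall j, d 0 j != 0) ->
  m%:R <= t < m.+1%:R ->
  let y j := ln `|d 0 j| in
  exists s, singular_value_function t (diag_mx d) = expR (flag_sum m (t - m%:R) y s) /\
    forall s', flag_sum m (t - m%:R) y s' <= flag_sum m (t - m%:R) y s.
Proof.
move=> d0 mt y; have [srt pe] := singular_values_diag d.
have tm : Num.truncn t = m by exact: truncn_def.
set sv := singular_values _ in srt pe *.
have ey j : expR (y j) = `|d 0 j| by rewrite /y lnK// posrE normr_gt0.
pose dt : n.-tuple R := map_tuple (fun j => `|d 0 j|) (ord_tuple n).
have [s svE] : exists s : {perm 'I_n}, sv = [tuple tnth dt (s i) | i < n].
  by apply/tuple_permP.
have svj (j : 'I_n) : sv`_j = expR (y (s j)).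
  rewrite svE ey (nth_map j) ?size_enum_ord// nth_ord_enum.
  by rewrite tnth_map tnth_ord_tuple.
have szs : size sv = n by rewrite svE size_tuple.
exists s; split.
  rewrite /singular_value_function tm -/sv flag_sum_affine expRD svj.
  congr (_ * _); last by rewrite /powR gt_eqF ?expR_gt0// expRK.
  rewrite expR_sum (big_ord_widen_cond n xpredT (fun j => sv`_j)) ?(ltnW (ltn_ord m))//=.
  by apply: eq_bigr => j _; rewrite svj.
move=> s'; apply: flag_sum_max.
  move: mt => /andP[mt tm1]; rewrite subr_ge0 mt/= lerBlDr addrC natr1; exact: ltW.
move=> i j ij; rewrite -ler_expR -!svj.
have geT : transitive (>=%R : rel R) by move=> a b c; exact: ge_trans.
have := sorted_leq_nth geT (@lexx _ R) 0 srt; apply => //; rewrite inE szs//.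
Qed.

End DiagonalSingularValues.

(** * The pressure of diagonal matrices *)

Section Growth.
Context {R : realType}.

(** Expanding the power by distributivity indexes its terms by words. *)
Lemma sum_tuple_prod (I : finType) (k : nat) (a : I -> R) :
  \sum_(w : k.-tuple I) \prod_(i <- w) a i = (\sum_i a i) ^+ k.
Proof.
rewrite -[k in RHS]card_ord -prodr_const bigA_distr_bigA/=.
rewrite (reindex (fun f : {ffun 'I_k -> I} => [tuple f i | i < k])) /=.
  by apply: eq_bigr => f _; rewrite big_map big_enum.
exists (fun w : k.-tuple I => [ffun i => tnth w i]) => [f _|w _].
  by apply/ffunP => i; rewrite ffunE tnth_mktuple.
by apply: eq_from_tnth => i; rewrite tnth_mktuple ffunE.
Qed.

(** [k^-1 * ln (Phi k)] lies between [ln G] and [ln G + k^-1 * ln N]. *)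
Lemma lim_ln_growth (Phi : nat -> R) (G N : R) : 0 < G -> 0 < N ->
  (forall k, G ^+ k <= Phi k <= N * G ^+ k) ->
  lim (k%:R^-1 * ln (Phi k) @[k --> \oo]) = ln G.
Proof.
move=> G0 N0 PhiE; apply: cvg_lim => //.
rewrite -(@cvg_shiftS _).
have lnS : ln G + harmonic k * ln N @[k --> \oo] --> ln G.
  rewrite -[X in _ --> X]addr0; apply: cvgD; first exact: cvg_cst.
  rewrite -(mul0r (ln N)); apply: cvgMr_tmp; exact: cvg_harmonic.
apply: (squeeze_cvgr _ (cvg_cst (ln G)) lnS).
near=> k; have /andP[l1 l2] := PhiE k.+1.
have Gk : 0 < G ^+ k.+1 by exact: exprn_gt0.
have Pk : 0 < Phi k.+1 by exact: lt_le_trans l1.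
have lnGk : ln (G ^+ k.+1) = k.+1%:R * ln G by rewrite lnXn// mulr_natl.
have e0 : 0 < k.+1%:R :> R by [].
apply/andP; split.
  by rewrite /= ler_pdivlMl// -lnGk ler_ln ?posrE.
rewrite /harmonic/= -ler_pdivlMl ?invr_gt0// invrK mulrDr mulrA mulfV ?gt_eqF// mul1r.
by rewrite -lnGk addrC -lnM ?posrE// ler_ln ?posrE ?mulr_gt0.
Unshelve. all: by end_near. Qed.

End Growth.

Section DiagonalPressure.
Context {R : realType} {n : nat} {I : finType}.
Variable A : I -> 'M[R]_n.
Hypothesis I0 : (0 < #|I|)%N.
Hypothesis Adiag : forall i, is_diag_mx (A i).
Hypothesis Aunit : forall i, A i \in unitmx.
Implicit Types (s : {perm 'I_n}) (t : R).

Definition log_entry (i : I) (j : 'I_n) : R := ln `|A i j j|.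

(** The function [g_s] of the introduction, written with exponents that are affine
in [t] itself; on [m <= t < m + 1] its logarithm is the pressure the matrices
would have if [s] were optimal for every word. *)
Definition flag_exp_sum (m : 'I_n) s : R -> R :=
  sum_exp (fun i => \sum_(j < n | (j < m)%N) log_entry i (s j) - m%:R * log_entry i (s m))
          (fun i => log_entry i (s m)).

Lemma flag_exp_sumE m s t :
  flag_exp_sum m s t = \sum_i expR (flag_sum m (t - m%:R) (log_entry i) s).
Proof. by apply: eq_bigr => i _; rewrite flag_sum_affine; congr expR; ring. Qed.

Lemma det_diag_entries i : \det (A i) = \prod_j A i j j.
Proof.
have /diag_mxP[d ->] := Adiag i; rewrite det_diag.
by apply: eq_bigr => j _; rewrite mxE eqxx mulr1n.
Qed.

Lemma diag_entry_neq0 i j : A i j j != 0.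
Proof.
have := Aunit i; rewrite unitmxE unitfE det_diag_entries => /prodf_neq0; exact.
Qed.

Lemma word_mx_diag (w : seq I) :
  word_mx A w = diag_mx (\row_j \prod_(i <- w) A i j j).
Proof.
elim: w => [|i w IHw].
  rewrite /word_mx big_nil; apply/matrixP => a b.
  by rewrite !mxE big_nil.
rewrite /word_mx big_cons -/(word_mx A w) IHw -[LHS]/(A i *m _).
have /diag_mxP[d Ad] := Adiag i; rewrite Ad mulmx_diag; congr diag_mx.
by apply/rowP => j; rewrite !mxE big_cons Ad mxE eqxx mulr1n.
Qed.

Lemma flag_sum_word m r s (w : seq I) :
  flag_sum m r (fun j => ln `|(\row_j \prod_(i <- w) A i j j) 0 j|) s =
  \sum_(i <- w) flag_sum m r (log_entry i) s.
Proof.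
rewrite exchange_big/=; apply: eq_bigr => j _; rewrite -mulr_sumr; congr (_ * _).
rewrite mxE; elim: w => [|i w IHw]; first by rewrite !big_nil normr1 ln1.
rewrite !big_cons normrM lnM ?posrE ?normr_gt0 ?diag_entry_neq0 ?IHw//.
by rewrite prodf_seq_neq0; apply/allP => k _; exact: diag_entry_neq0.
Qed.

(** The optimal permutation depends on the word; both bounds are uniform in
the word, at the price of a sum over permutations in the upper one. *)
Lemma singular_value_function_word (m : 'I_n) t (w : seq I) :
  m%:R <= t < m.+1%:R ->
  let a s i := expR (flag_sum m (t - m%:R) (log_entry i) s) in
  (forall s, \prod_(i <- w) a s i <= singular_value_function t (word_mx A w)) /\
  singular_value_function t (word_mx A w) <= \sum_s \prod_(i <- w) a s i.
Proof.
move=> mt a; rewrite word_mx_diag.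
have [|s [-> smax]] := @singular_value_function_diag _ _
    (\row_j \prod_(i <- w) A i j j) m t _ mt.
  by move=> j; rewrite mxE; rewrite prodf_seq_neq0; apply/allP => k _; exact: diag_entry_neq0.
have aE s' : \prod_(i <- w) a s' i = expR (flag_sum m (t - m%:R)
    (fun j => ln `|(\row_j \prod_(i <- w) A i j j) 0 j|) s').
  by rewrite flag_sum_word expR_sum.
split=> [s'|]; first by rewrite aE ler_expR smax.
rewrite (bigD1 s)//= aE lerDl sumr_ge0// => s' _.
by rewrite aE expR_ge0.
Qed.

(** The sum over words is at least [flag_exp_sum m s t ^+ k], and at most [n!]
times that, since every permutation contributes at most as much as [s]. *)
Lemma pressure_dominant (m : 'I_n) t s : m%:R <= t < m.+1%:R ->
  (forall s', flag_exp_sum m s' t <= flag_exp_sum m s t) ->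
  pressure A t = ln (flag_exp_sum m s t).
Proof.
move=> mt smax; have /andP[_ tm] := mt.
have tn : t < n%:R by rewrite (lt_le_trans tm)// ler_nat.
rewrite /pressure tn.
apply: (@lim_ln_growth _ _ _ #|{perm 'I_n}|%:R).
- exact: sum_exp_gt0.
- by rewrite ltr0n; apply/card_gt0P; exists s.
move=> k; have word s' : \sum_(w : k.-tuple I) \prod_(i <- w)
    expR (flag_sum m (t - m%:R) (log_entry i) s') = flag_exp_sum m s' t ^+ k.
  by rewrite sum_tuple_prod flag_exp_sumE.
apply/andP; split.
  rewrite -word; apply: ler_sum => w _.
  by have [+ _] := singular_value_function_word w mt; exact.
apply: (@le_trans _ _ (\sum_s' flag_exp_sum m s' t ^+ k)).
  under [leRHS]eq_bigr do rewrite -word.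
  rewrite exchange_big/=; apply: ler_sum => w _.
  by have [] := singular_value_function_word w mt.
rewrite mulr_natl -sumr_const; apply: ler_sum => s' _.
by rewrite lerXn2r ?nnegrE /flag_exp_sum ?(ltW (sum_exp_gt0 _ _ _ _))//; exact: smax.
Qed.

Lemma pressure_ge t : n%:R <= t ->
  pressure A t = ln (sum_exp (fun=> 0) (fun i => ln `|\det (A i)| / n%:R) t).
Proof.
move=> nt; rewrite /pressure ltNge nt/=; congr ln; apply: eq_bigr => i _.
have di : `|\det (A i)| != 0.
  by rewrite normr_eq0 -unitfE -unitmxE.
by rewrite /powR (negPf di) add0r; congr expR; ring.
Qed.

End DiagonalPressure.

(** * Piecewise analyticity of the pressure *)

Lemma sum_exp_comb (R : realType) (I : finType) (u v : I -> R) t :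
  sum_exp u v t = exp_comb [seq (expR (u i), v i) | i <- index_enum I] t.
Proof. by rewrite /exp_comb big_map; apply: eq_bigr => i _; rewrite expRD. Qed.

Lemma eq_real_analytic (R : realType) (U : set R) (f g : R -> R) :
  {in U, f =1 g} -> real_analytic_on U g -> real_analytic_on U f.
Proof.
move=> fg gU a /gU[c [r [r0 gP]]]; exists c, r; split => // x Ux xr.
by rewrite fg ?inE//; exact: gP.
Qed.

Lemma itv_lt_of_notin (R : realType) (J : interval R) (x y z : R) :
  x \in J -> y \in J -> z \notin J -> (x < z) = (y < z).
Proof.
move=> xJ yJ /negP zJ.
have Jz a b : a \in J -> b \in J -> a <= z <= b -> False.
  by move=> aJ bJ azb; apply: zJ; exact: (@interval_is_interval _ J a b aJ bJ).
case: (ltP x z) => [xz|zx]; case: (ltP y z) => [yz|zy] //; exfalso.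
  by apply: (Jz x y) => //; rewrite (ltW xz).
by apply: (Jz y x) => //; rewrite (ltW yz).
Qed.

Unset Implicit Arguments.

Theorem corollary2p2 (R : realType) (n : nat) (hn : (0 < n)%N)
  (I : finType) (hI : (0 < #|I|)%N) (A : I -> 'M[R]_n)
  (hdiag : forall i, is_diag_mx (A i)) (hns : forall i, A i \in unitmx) :
  piecewise_real_analytic `[0, +oo[ (pressure A).
Proof.
pose comb (m : 'I_n) (s : {perm 'I_n}) :=
  [seq (expR (\sum_(j < n | (j < m)%N) log_entry A i (s j)
                              - m%:R * log_entry A i (s m)), log_entry A i (s m))
                 | i <- index_enum I].
have combE (m : 'I_n) s t : exp_comb (comb m s) t = flag_exp_sum A m s t.
  by rewrite /flag_exp_sum sum_exp_comb.
have /choice[cross crossP] := fun m : 'I_n => exp_comb_dominant (1%g : {perm 'I_n}) (comb m).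
pose integers : seq R := [seq k%:R | k <- iota 0 n.+1].
apply: (@piecewise_of_breakpoints _ _
  (integers ++ flatten [seq cross m | m <- enum 'I_n])) => J J0 ZJ.
have [[x xJ]|Jempty] := pselect (exists x, x \in J); last first.
  by move=> t tJ; exfalso; apply: Jempty; exists t.
have side k t : (k <= n)%N -> t \in J -> (t < k%:R) = (x < k%:R).
  move=> kn tJ; apply: (itv_lt_of_notin tJ xJ); apply: ZJ.
  by rewrite mem_cat map_f// mem_iota.
(* No integer of [0, n] lies in J, so the formula that defines the pressure is
   the same on all of J. *)
have [xn|nx] := ltP x n%:R.
  have /andP[mx xm] := truncn_itv (ltW (J0 x xJ)).
  have mn : (Num.truncn x < n)%N by rewrite -(ltr_nat R) (le_lt_trans mx).
  pose m := Ordinal mn.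
  have Jm t : t \in J -> m%:R <= t < m.+1%:R.
    by move=> tJ; rewrite leNgt !side ?xm ?andbT -?leNgt// ltnW.
  have [|s sP] := crossP m J.
    move=> z zm; apply: ZJ; rewrite mem_cat; apply/orP; right.
    by apply/flatten_mapP; exists m => //; rewrite mem_enum.
  have an : real_analytic_on [set` J] (fun t => ln (flag_exp_sum A m s t)).
    exact: log_sum_exp_analytic.
  apply: (eq_real_analytic _ an) => t; rewrite inE => tJ.
  apply: (pressure_dominant hI hdiag hns (Jm t tJ)) => s'.
  by rewrite -!combE sP.
have an : real_analytic_on [set` J]
    (fun t => ln (sum_exp (fun=> 0) (fun i => ln `|\det (A i)| / n%:R) t)).
  exact: log_sum_exp_analytic.
apply: (eq_real_analytic _ an) => t.
by rewrite inE => tJ; apply: (pressure_ge hns); rewrite leNgt side// -leNgt.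
Qed.
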